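(* Let $H$ be the $nr\times nr$ skew-symmetric matrix built from $A,M$ as in the context, let $s=\operatorname{corank}(H)$, and suppose there is an $nr\times nr$ matrix $K$ such that $$KH=\begin{pmatrix}\mathbb I_{nr-s}&Y\\0&0_s\end{pmatrix}$$ for some $(nr-s)\times s$ matrix $Y$. Let $\mathbb T_{a,b,d}=\begin{pmatrix}a&b\\0&d\end{pmatrix}$ be an invertible upper triangular matrix, with $a$ of size $(nr-s)\times(nr-s)$ and $d$ of size $s\times s$. Put $$\Lambda_{a,b,d}=\mathbb T_{a,b,d}^tH\,\mathbb T_{a,b,d},\qquad \tilde B_{a,b,d}=2\left(\mathbb T_{a,b,d}^{-1}K(\mathbb T_{a,b,d}^t)^{-1}\right)^t,$$ and let $B_{a,b,d}$ be the $nr\times(nr-s)$ matrix obtained from $\tilde B_{a,b,d}$ by removing the last $s$ columns. If $b=-Yd$, then $(\Lambda_{a,b,d},B_{a,b,d})$ is a compatible pair, satisfying $$\Lambda_{a,b,d}B_{a,b,d}=\begin{pmatrix}-2\,\mathbb I_{nr-s}\\0_{s\times(nr-s)}\end{pmatrix}.$$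
   Context: $n,r$ are positive integers; $A,M$ are integer $r\times r$ matrices with $A^t=-A$, $N=-M^t$, and $H$ is the $nr\times nr$ matrix of $n\times n$ blocks of size $r\times r$ with diagonal blocks $A$, blocks $M$ above the diagonal and blocks $N$ below the diagonal. A pair $(\Lambda,B)$, with $\Lambda$ a skew-symmetric $nr\times nr$ matrix and $B$ an $nr\times c$ matrix, is called compatible (in the special form used here) if $\Lambda B=\begin{pmatrix}-2\mathbb I_c\\0\end{pmatrix}$. *)

(* Defs.v *)
From HB Require Import structures.
From mathcomp Require Import all_boot all_order all_algebra.
Set Implicit Arguments.
Unset Strict Implicit.
Unset Printing Implicit Defensive.
Import GRing.Theory.
Local Open Scope ring_scope.

Lemma sum_ord_const (n r : nat) : (\sum_(i < n) r = n * r)%N.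
Proof. by rewrite sum_nat_const card_ord. Qed.

Definition Hmx (n r : nat) (A M N : 'M[int]_r) : 'M[int]_(n * r) :=
  castmx (sum_ord_const n r, sum_ord_const n r)
    (\mxblock_(i < n, j < n)
       (if i == j then A else if (i < j)%N then M else N)).

Definition corank (F : fieldType) (m : nat) (X : 'M[F]_m) : nat :=
  (m - \rank X)%N.

Definition block_of (F : fieldType) (m k s : nat) (hks : (k + s = m)%N)
    (ul : 'M[F]_k) (ur : 'M[F]_(k, s)) (dl : 'M[F]_(s, k)) (dr : 'M[F]_s) :
    'M[F]_m :=
  castmx (hks, hks) (block_mx ul ur dl dr).

Definition minus2_stack (F : fieldType) (m c d : nat) (hcd : (c + d = m)%N) :
    'M[F]_(m, c) :=
  castmx (hcd, erefl c) (col_mx (- 2%:R)%:M (0 : 'M[F]_(d, c))).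

Definition compatible (F : fieldType) (m c : nat)
    (Lambda : 'M[F]_m) (B : 'M[F]_(m, c)) : Prop :=
  Lambda^T = - Lambda /\
  exists (d : nat) (hcd : (c + d = m)%N), Lambda *m B = minus2_stack F hcd.

Definition Tmx (F : fieldType) (m k s : nat) (hks : (k + s = m)%N)
    (a : 'M[F]_k) (b : 'M[F]_(k, s)) (d : 'M[F]_s) : 'M[F]_m :=
  block_of hks a b 0 d.

Definition Lambda_mx (F : fieldType) (m : nat) (H T : 'M[F]_m) : 'M[F]_m :=
  T^T *m H *m T.

Definition Btilde_mx (F : fieldType) (m : nat) (K T : 'M[F]_m) : 'M[F]_m :=
  2%:R *: (invmx T *m K *m invmx T^T)^T.

Definition drop_last_cols (F : fieldType) (m k s : nat) (hks : (k + s = m)%N)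
    (X : 'M[F]_m) : 'M[F]_(m, k) :=
  lsubmx (castmx (erefl m, esym hks) X).

(* Main.v *)
(** Skew-symmetry of [H] gives [Lambda * Btilde = -2 (T^-1 (K H) T)^t].  The
choice [b = - Y d] is exactly what makes [(K H) T] equal to [diag(a, 0)], which
is also [T diag(1, 0)]; hence [T^-1 (K H) T = diag(1, 0)]. *)

Require Import Defs.
From HB Require Import structures.
From mathcomp Require Import all_boot all_order all_algebra.
Set Implicit Arguments.
Unset Strict Implicit.
Unset Printing Implicit Defensive.
Import GRing.Theory.
Local Open Scope ring_scope.

Lemma Hmx_skew (n r : nat) (A M N : 'M[int]_r) :
  A^T = - A -> N = - M^T -> (Hmx n A M N)^T = - Hmx n A M N.
Proof.
move=> skewA defN; rewrite /Hmx; case: _ / (sum_ord_const n r).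
rewrite !castmx_id tr_mxblock -mxblockN; apply: eq_mxblock => i j.
rewrite eq_sym; case: eqVneq => // neq_ij.
(* Transposition carries block (j, i) to (i, j), so [M^T = - N] is needed below the diagonal and
   [N^T = - M] above it. *)
rewrite defN; case: ltngtP => [_|_|/ord_inj eq_ij].
- by rewrite opprK.
- by rewrite linearN /= trmxK.
- by rewrite eq_ij eqxx in neq_ij.
Qed.

Lemma Lambda_mx_skew (F : fieldType) (m : nat) (H T : 'M[F]_m) :
  H^T = - H -> (Lambda_mx H T)^T = - Lambda_mx H T.
Proof.
by move=> skewH; rewrite /Lambda_mx !trmx_mul trmxK skewH mulNmx mulmxN mulmxA.
Qed.

(** The inner factors [T] and [T^-1] cancel, leaving [2 T^t H K^t (T^-1)^t], and skew-symmetry turns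
    [H K^t] into [- (K H)^t]. *)
Lemma Lambda_mul_Btilde (F : fieldType) (m : nat) (H K T : 'M[F]_m) :
    H^T = - H -> T \in unitmx ->
  Lambda_mx H T *m Btilde_mx K T = - 2%:R *: (invmx T *m (K *m H) *m T)^T.
Proof.
move=> skewH unitT; rewrite /Lambda_mx /Btilde_mx -scalemxAr !trmx_mul skewH.
rewrite trmx_inv trmxK !mulNmx mulmxN scaleNr scalerN opprK.
by rewrite !mulmxA mulmxK.
Qed.

Lemma conj_Tmx_block (F : fieldType) (m k s : nat) (hks : (k + s = m)%N)
    (Y : 'M[F]_(k, s)) (a : 'M[F]_k) (d : 'M[F]_s) :
  let T := Tmx hks a (- (Y *m d)) d in T \in unitmx ->
  invmx T *m block_of hks 1%:M Y 0 0 *m T = block_of hks 1%:M 0 0 0.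
Proof.
case: m / hks; rewrite /Tmx /block_of !castmx_id /= => unitT.
(* Moving [T^-1] to the other side avoids inverting [T] by blocks. *)
rewrite -mulmxA; apply: (canLR (mulKmx unitT)).
by rewrite !mulmx_block !(mul1mx, mulmx1, mul0mx, mulmx0, addr0, add0r) addNr.
Qed.

(** Left multiplication acts column by column, so the product can be computed with the square
    [Btilde_mx] and truncated afterwards. *)
Lemma drop_last_cols_mul (F : fieldType) (m k s : nat) (hks : (k + s = m)%N)
    (X Z : 'M[F]_m) :
  X *m drop_last_cols hks Z = drop_last_cols hks (X *m Z).
Proof. by case: m / hks X Z => X Z; rewrite /drop_last_cols !castmx_id mulmx_lsub. Qed.

Lemma drop_last_cols_diag (F : fieldType) (m k s : nat) (hks : (k + s = m)%N) :
  drop_last_cols hks (- 2%:R *: (block_of hks 1%:M 0 0 0)^T)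
    = minus2_stack F hks.
Proof.
case: m / hks; rewrite /drop_last_cols /block_of /minus2_stack !castmx_id.
(* Seen as a row of two block columns, the matrix loses the second one. *)
rewrite tr_block_mx scale_block_mx block_mxEh row_mxKl trmx1 !trmx0 scaler0.
by rewrite scalemx1.
Qed.

Theorem proposition6p1
  (F : fieldType) (F_char0 : [pchar F] =i pred0)
  (n r : nat) (n_gt0 : (0 < n)%N) (r_gt0 : (0 < r)%N)
  (A M N : 'M[int]_r) (skewA : A^T = - A) (defN : N = - M^T)
  (H : 'M[F]_(n * r)) (defH : H = map_mx intr (Hmx n A M N))
  (k s : nat) (hks : (k + s = n * r)%N) (defs : s = corank H)
  (K : 'M[F]_(n * r)) (Y : 'M[F]_(k, s))
  (defKH : K *m H = block_of hks 1%:M Y 0 0)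
  (a : 'M[F]_k) (b : 'M[F]_(k, s)) (d : 'M[F]_s)
  (unitT : Tmx hks a b d \in unitmx)
  (defb : b = - (Y *m d)) :
  let T := Tmx hks a b d in
  let Lambda := Lambda_mx H T in
  let B := drop_last_cols hks (Btilde_mx K T) in
  compatible Lambda B /\ Lambda *m B = minus2_stack F hks.
Proof.
move=> T Lambda B.
have skewH : H^T = - H.
  (* Skew-symmetry passes from the integers to [F] entrywise. *)
  by rewrite defH map_trmx (Hmx_skew _ skewA defN) map_mxN.
have LambdaB : Lambda *m B = minus2_stack F hks.
  rewrite /B drop_last_cols_mul Lambda_mul_Btilde // defKH.
  move: unitT; rewrite /T defb => /conj_Tmx_block ->.
  exact: drop_last_cols_diag.
split=> //; split; first exact: Lambda_mx_skew.
(* The number of zero rows that [compatible] leaves open is the corank [s]. *)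
by exists s, hks.
Qed.
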